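(* Let $\mathbf x_1,\dots,\mathbf x_n\in\mathbb R^p$ be training points with labels $y_1,\dots,y_n\in\{-1,1\}$, let $\mathbf x_{n+1},\dots,\mathbf x_{n+m}\in\mathbb R^p$ be test points, let $\boldsymbol\psi:\mathbb R^p\to\mathbb Y$ be a map into a real Hilbert space $\mathbb Y$, and let $C>0$. Let $\mathbf K\in\mathbb R^{(n+m)\times(n+m)}$ be the positive semidefinite matrix $K_{ij}=\langle\boldsymbol\psi(\mathbf x_i),\boldsymbol\psi(\mathbf x_j)\rangle$, $i,j=1,\dots,n+m$. Let $q=\operatorname{rank}(\mathbf K)$ and let $$\mathbf K=\begin{bmatrix}\mathbf F_r\\ \mathbf F_e\end{bmatrix}\begin{bmatrix}\mathbf F_r^\top&\mathbf F_e^\top\end{bmatrix},\qquad \mathbf F_r\in\mathbb R^{n\times q},\ \mathbf F_e\in\mathbb R^{m\times q},$$ be any such decomposition of $\mathbf K$; denote the rows of $\mathbf F_r$ by $\hat{\mathbf x}_1^\top,\dots,\hat{\mathbf x}_n^\top$ and the rows of $\mathbf F_e$ by $\hat{\mathbf x}_{n+1}^\top,\dots,\hat{\mathbf x}_{n+m}^\top$. Then the $L_2$-loss kernel SVM $$\min_{\mathbf w\in\mathbb Y,\,b\in\mathbb R}\ \frac12\|\mathbf w\|^2+C\sum_{i=1}^n\max\bigl(0,\,1-y_i(\langle\mathbf w,\boldsymbol\psi(\mathbf x_i)\rangle+b)\bigr)^2$$ trained on $(\mathbf x_i,y_i)_{i=1}^n$ and tested on $\mathbf x_{n+1},\dots,\mathbf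 x_{n+m}$ is equivalent to the $L_2$-loss linear SVM $$\min_{\mathbf w\in\mathbb R^q,\,b\in\mathbb R}\ \frac12\|\mathbf w\|^2+C\sum_{i=1}^n\max\bigl(0,\,1-y_i(\mathbf w^\top\hat{\mathbf x}_i+b)\bigr)^2$$ trained on $(\hat{\mathbf x}_i,y_i)_{i=1}^n$ and tested on $\hat{\mathbf x}_{n+1},\dots,\hat{\mathbf x}_{n+m}$, in the following sense: for every optimal solution $(\mathbf w^*,b^* )$ of the kernel SVM there is an optimal solution $(\hat{\mathbf w}^*,\hat b^* )$ of the linear SVM, and conversely for every optimal solution $(\hat{\mathbf w}^*,\hat b^* )$ of the linear SVM there is an optimal solution $(\mathbf w^*,b^* )$ of the kernel SVM, such that $$\langle\mathbf w^*,\boldsymbol\psi(\mathbf x_i)\rangle+b^*=(\hat{\mathbf w}^* )^\top\hat{\mathbf x}_i+\hat b^*\qquad\text{for all } i=n+1,\dots,n+m,$$ so that the predicted values, and hence the predicted labels (their signs), coincide on all test points.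
   Context: The predicted value of a trained kernel SVM with optimal solution $(\mathbf w^*,b^* )$ at a point $\mathbf x$ is $\langle\mathbf w^*,\boldsymbol\psi(\mathbf x)\rangle+b^*$, and the predicted label is its sign; for a linear SVM the feature map $\boldsymbol\psi$ is replaced by the identity. $\|\cdot\|$ is the Hilbert space norm (Euclidean on $\mathbb R^q$). *)

(* Defs.v *)
From mathcomp Require Import all_boot all_order all_algebra.
From mathcomp Require Import reals topology normedtype.

Set Implicit Arguments.
Unset Strict Implicit.
Unset Printing Implicit Defensive.

Import Order.TTheory GRing.Theory Num.Theory numFieldNormedType.Exports.
Local Open Scope ring_scope.

(* A real Hilbert space is a complete normed module whose norm is induced by
   a positive definite symmetric bilinear form. *)
Definition norm_from_inner (R : realType) (Y : completeNormedModType R)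
    (ip : {dot Y for @idfun R}) : Prop :=
  forall v : Y, `|v| = Num.sqrt (ip v v).

(* The canonical norm `|_| on 'rV[R]_q is the sup norm, hence an explicit
   Euclidean norm. *)
Definition dotv (R : realType) (q : nat) (u v : 'rV[R]_q) : R :=
  (u *m v^T) 0 0.

Definition enorm (R : realType) (q : nat) (u : 'rV[R]_q) : R :=
  Num.sqrt (dotv u u).

Section SVM.
Context {R : realType} {V : Type}.
Variables (nrm : V -> R) (ip : V -> V -> R).

Definition svm_value (w : V) (b : R) (z : V) : R := ip w z + b.

(* The label is 0 when the predicted value is 0. *)
Definition svm_label (w : V) (b : R) (z : V) : R := Num.sg (svm_value w b z).

Definition l2svm_objective (n : nat) (C : R) (z : 'I_n -> V) (y : 'I_n -> R)
    (w : V) (b : R) : R :=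
  2^-1 * nrm w ^+ 2 +
  C * \sum_(i < n) Num.max 0 (1 - y i * svm_value w b (z i)) ^+ 2.

Definition l2svm_optimal (n : nat) (C : R) (z : 'I_n -> V) (y : 'I_n -> R)
    (w : V) (b : R) : Prop :=
  forall (w' : V) (b' : R),
    l2svm_objective C z y w b <= l2svm_objective C z y w' b'.

End SVM.

Definition kernel_matrix (R : realType) (p N : nat) (V : Type)
    (ip : V -> V -> R) (psi : 'rV[R]_p -> V) (x : 'I_N -> 'rV[R]_p) : 'M[R]_N :=
  \matrix_(i, j) ip (psi (x i)) (psi (x j)).

(* Main.v *)
(* Since F has full column rank, it has a left inverse G, and
   T u = \sum_j (u G)_j psi(x_j) is an isometric embedding of R^q into the
   feature space sending each row of F to the corresponding psi(x_j).  Its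
   adjoint S satisfies S T = 1 and does not increase norms, and S and T both
   preserve predicted values at all the data points.  Hence T preserves the
   objective, S does not increase it, and both map minimizers to minimizers. *)
Require Import Defs.
From mathcomp Require Import all_boot all_order all_algebra.
From mathcomp Require Import reals topology normedtype.

Set Implicit Arguments.
Unset Strict Implicit.
Unset Printing Implicit Defensive.

Import Order.TTheory GRing.Theory Num.Theory numFieldNormedType.Exports.
Local Open Scope ring_scope.

(** The rank of a product is at most that of its right factor, so [q] is at most the rank of [F^T],
    which is the rank of [F]; hence [F] has full column rank. *)
Lemma mul_trmx_left_invertible (R : realFieldType) (N q : nat)
    (F : 'M[R]_(N, q)) :
  q = \rank (F *m F^T) -> exists G : 'M[R]_(q, N), G *m F = 1%:M.
Proof.
move=> hq; have : row_full F.
  rewrite /row_full eqn_leq rank_leq_col /= {1}hq -(mxrank_tr F).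
  exact: mxrankM_maxr.
by move=> /row_fullP.
Qed.

Section DotProduct.
Variables (R : realType) (U : lmodType R) (ip : {dot U for @idfun R}).

Lemma dot_sym (u v : U) : ip u v = ip v u.
Proof. by rewrite hermC expr0 mul1r. Qed.

Lemma dot_ge0 (u : U) : 0 <= ip u u.
Proof.
by have [->|/neq0_dnorm_gt0 /ltW //] := eqVneq u 0; rewrite linear0r.
Qed.

Lemma dot_eq0 (u : U) : ip u u = 0 -> u = 0.
Proof.
by have [//|/(@neq0_dnorm_gt0 _ _ _ ip)] := eqVneq u 0; rewrite lt_def => /andP[/eqP].
Qed.

Definition lincomb (N : nat) (P : 'I_N -> U) (a : 'rV[R]_N) : U :=
  \sum_j a 0 j *: P j.

Lemma dot_lincombr (N : nat) (P : 'I_N -> U) (w : U) (a : 'rV[R]_N) :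
  ip w (lincomb P a) = dotv (\row_j ip w (P j)) a.
Proof.
rewrite /dotv /lincomb linear_sumr mxE; apply: eq_bigr => j _.
by rewrite linearZr_LR !mxE /= mulrC.
Qed.

Lemma row_dot_lincomb (N : nat) (P : 'I_N -> U) (a : 'rV[R]_N) :
  \row_j ip (lincomb P a) (P j) = a *m \matrix_(i, j) ip (P i) (P j).
Proof.
apply/rowP => j; rewrite !mxE dot_sym dot_lincombr /dotv !mxE.
by apply: eq_bigr => i _; rewrite !mxE mulrC dot_sym.
Qed.

Lemma lincombB (N : nat) (P : 'I_N -> U) (a b : 'rV[R]_N) :
  lincomb P (a - b) = lincomb P a - lincomb P b.
Proof.
by rewrite /lincomb -sumrB; apply: eq_bigr => j _; rewrite !mxE scalerBl.
Qed.

Lemma lincomb_delta (N : nat) (P : 'I_N -> U) (j : 'I_N) :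
  lincomb P (delta_mx 0 j) = P j.
Proof.
rewrite /lincomb (bigD1 j) //= big1 => [|i ij]; rewrite mxE ?eqxx ?scale1r ?addr0 //.
by rewrite (negPf ij) andbF scale0r.
Qed.

(** The combination of the [P j] with coefficients [a] has squared norm [a F F^T a^T], so every
    linear relation among the rows of [F] also holds among the [P j]. Hence [u *m G] may serve as
    the coefficients of [u]: it satisfies [u G F = u]. *)
Lemma gram_embedding (N q : nat) (P : 'I_N -> U) (F : 'M[R]_(N, q)) :
    \matrix_(i, j) ip (P i) (P j) = F *m F^T ->
    q = \rank (F *m F^T) ->
  exists (T : 'rV[R]_q -> U) (S : U -> 'rV[R]_q),
    [/\ forall w u, ip w (T u) = dotv (S w) u,
        forall u, S (T u) = u
      & forall j, T (row j F) = P j].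
Proof.
move=> gramP /mul_trmx_left_invertible[G GF].
(* The second map is forced by adjointness: moving [G] across the dot product turns it into
   [G^T]. *)
exists (fun u => lincomb P (u *m G)), (fun w => (\row_j ip w (P j)) *m G^T).
split=> [w u|u|j].
- by rewrite dot_lincombr /dotv trmx_mul mulmxA.
- rewrite row_dot_lincomb gramP -!mulmxA -trmx_mul GF trmx1 mulmx1.
  by rewrite GF mulmx1.
(* The difference is a combination of the P i orthogonal to every P i. *)
apply/eqP; rewrite -subr_eq0 -[X in _ - X]lincomb_delta -lincombB.
apply/eqP/dot_eq0; rewrite dot_lincombr row_dot_lincomb gramP mulmxBl.
by rewrite -rowE row_mul mulmxA -(mulmxA _ G) GF mulmx1 subrr /dotv mul0mx mxE.
Qed.

End DotProduct.

Lemma dotv_ge0 (R : realType) (q : nat) (u : 'rV[R]_q) : 0 <= dotv u u.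
Proof. by rewrite /dotv mxE sumr_ge0 // => i _; rewrite !mxE -expr2 sqr_ge0. Qed.

Lemma enorm_sqr (R : realType) (q : nat) (u : 'rV[R]_q) :
  enorm u ^+ 2 = dotv u u.
Proof. by rewrite sqr_sqrtr ?dotv_ge0. Qed.

(** [T (S w)] is the orthogonal projection of [w] onto the range of [T]; the squared norm of the
    residual [w - T (S w)] is exactly the difference of the two sides. *)
Lemma adjoint_contraction (R : realType) (U : lmodType R)
    (ip : {dot U for @idfun R}) (q : nat)
    (T : 'rV[R]_q -> U) (S : U -> 'rV[R]_q) :
    (forall w u, ip w (T u) = dotv (S w) u) -> (forall u, S (T u) = u) ->
  forall w, dotv (S w) (S w) <= ip w w.
Proof.
move=> adj ST w; have := dot_ge0 ip (w - T (S w)).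
rewrite linearBl !linearBr /= (dot_sym ip (T _) w) !adj ST subrr subr0.
by rewrite subr_ge0.
Qed.

Lemma l2svm_objective_le (R : realType) (V W : Type)
    (nrmV : V -> R) (ipV : V -> V -> R) (nrmW : W -> R) (ipW : W -> W -> R)
    (n : nat) (C : R) (y : 'I_n -> R) (zV : 'I_n -> V) (zW : 'I_n -> W)
    (v : V) (w : W) (b : R) :
    0 <= C -> nrmV v ^+ 2 <= nrmW w ^+ 2 ->
    (forall i, ipV v (zV i) = ipW w (zW i)) ->
  l2svm_objective nrmV ipV C zV y v b <= l2svm_objective nrmW ipW C zW y w b.
Proof.
move=> C_ge0 le_nrm eq_ip; rewrite /l2svm_objective lerD //.
  by rewrite ler_wpM2l // invr_ge0 ler0n.
by rewrite ler_wpM2l // ler_sum // => i _; rewrite /svm_value eq_ip.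
Qed.

(** A competitor [v'] is pulled back through [g]: the objective at [f w] is at most that at [w],
    then at [g v'], then at [v']. The symmetric hypotheses let [S] and [T] exchange roles. *)
Lemma l2svm_optimal_transfer (R : realType) (V W : Type)
    (nrmV : V -> R) (ipV : V -> V -> R) (nrmW : W -> R) (ipW : W -> W -> R)
    (n : nat) (C : R) (y : 'I_n -> R) (zV : 'I_n -> V) (zW : 'I_n -> W)
    (f : W -> V) (g : V -> W) (w : W) (b : R) :
    0 <= C ->
    (forall w', nrmV (f w') ^+ 2 <= nrmW w' ^+ 2) ->
    (forall w' i, ipV (f w') (zV i) = ipW w' (zW i)) ->
    (forall v', nrmW (g v') ^+ 2 <= nrmV v' ^+ 2) ->
    (forall v' i, ipW (g v') (zW i) = ipV v' (zV i)) ->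
  l2svm_optimal nrmW ipW C zW y w b -> l2svm_optimal nrmV ipV C zV y (f w) b.
Proof.
move=> C_ge0 nf ipf ng ipg opt v' b'.
apply: le_trans (l2svm_objective_le y b C_ge0 (nf w) (ipf w)) _.
exact: le_trans (opt (g v') b') (l2svm_objective_le y b' C_ge0 (ng v') (ipg v')).
Qed.

Theorem theorem1 (R : realType) (n m p q : nat)
    (x : 'I_(n + m) -> 'rV[R]_p) (y : 'I_n -> R)
    (hy : forall i : 'I_n, y i = -1 \/ y i = 1)
    (Y : completeNormedModType R) (ip : {dot Y for @idfun R})
    (hip : norm_from_inner ip)
    (psi : 'rV[R]_p -> Y) (C : R) (hC : 0 < C)
    (hq : q = \rank (kernel_matrix ip psi x))
    (Fr : 'M[R]_(n, q)) (Fe : 'M[R]_(m, q))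
    (hF : kernel_matrix ip psi x = col_mx Fr Fe *m row_mx Fr^T Fe^T) :
  let kernel_opt (w : Y) (b : R) :=
    l2svm_optimal (fun v : Y => `|v|) ip C
      (fun i : 'I_n => psi (x (lshift m i))) y w b in
  let linear_opt (w : 'rV[R]_q) (b : R) :=
    l2svm_optimal (@enorm R q) (@dotv R q) C (fun i : 'I_n => row i Fr) y w b in
  let same_predictions (w : Y) (b : R) (w' : 'rV[R]_q) (b' : R) :=
    forall j : 'I_m,
      svm_value ip w b (psi (x (rshift n j))) =
        svm_value (@dotv R q) w' b' (row j Fe)
      /\ svm_label ip w b (psi (x (rshift n j))) =
        svm_label (@dotv R q) w' b' (row j Fe) in
  (forall (w : Y) (b : R), kernel_opt w b ->
     exists (w' : 'rV[R]_q) (b' : R),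
       linear_opt w' b' /\ same_predictions w b w' b')
  /\
  (forall (w' : 'rV[R]_q) (b' : R), linear_opt w' b' ->
     exists (w : Y) (b : R),
       kernel_opt w b /\ same_predictions w b w' b').
Proof.
move=> kernel_opt linear_opt same_predictions.
pose P j := psi (x j); pose F := col_mx Fr Fe.
have gramP : \matrix_(i, j) ip (P i) (P j) = F *m F^T by rewrite tr_col_mx -hF.
have rankF : q = \rank (F *m F^T) by rewrite -gramP.
have [T [S [adj ST TF]]] := gram_embedding gramP rankF.
(* Training and test points are both rows of [F], so the same identities control the losses and the
   predictions. *)
have rowFr i : row i Fr = row (lshift m i) F by rewrite -row_usubmx col_mxKu.
have rowFe j : row j Fe = row (rshift n j) F by rewrite -row_dsubmx col_mxKd.
have nrmE v : `|v| ^+ 2 = ip v v by rewrite hip sqr_sqrtr ?dot_ge0.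
have ipS w j : dotv (S w) (row j F) = ip w (P j) by rewrite -adj TF.
have ipT u j : ip (T u) (P j) = dotv u (row j F) by rewrite -TF adj ST.
have nrmS w : enorm (S w) ^+ 2 <= `|w| ^+ 2.
  by rewrite enorm_sqr nrmE (adjoint_contraction adj ST).
have nrmT u : `|T u| ^+ 2 <= enorm u ^+ 2 by rewrite enorm_sqr nrmE adj ST.
have ipSl w i : dotv (S w) (row i Fr) = ip w (P (lshift m i)) by rewrite rowFr.
have ipTl u i : ip (T u) (P (lshift m i)) = dotv u (row i Fr) by rewrite rowFr.
split=> [w b opt|u b opt].
  (* The inner products already agree at every data point, so the bias is kept unchanged. *)
  exists (S w), b; split; last by move=> j; rewrite /svm_label /svm_value rowFe ipS.
  exact: (l2svm_optimal_transfer (ltW hC) nrmS ipSl nrmT ipTl opt).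
exists (T u), b; split; last by move=> j; rewrite /svm_label /svm_value rowFe -ipT.
exact: (l2svm_optimal_transfer (ltW hC) nrmT ipTl nrmS ipSl opt).
Qed.
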